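(* Let $R$ be a commutative noetherian local ring. Then the following conditions are equivalent: (1) One of the following conditions holds for each Serre subcategory $\mathcal{S}$ of $R\text{-}\mathrm{Mod}$: (a) $\mathbb{M}[\mathcal{S}]=\mathrm{Spec}(R)$; (b) $\mathbb{M}[\mathcal{S}]=\{\mathfrak{p}\}$ for a minimal prime ideal $\mathfrak{p}$ of $R$; (c) $\mathbb{M}[\mathcal{S}]=\emptyset$. (2) $R$ has dimension at most one.
   Context: All rings are commutative noetherian and all modules are unitary. $R\text{-}\mathrm{Mod}$ is the category of all $R$-modules; subcategories are full and closed under isomorphisms. A Serre subcategory of $R\text{-}\mathrm{Mod}$ is a (nonempty) subcategory closed under taking submodules, quotient modules and extensions. For an ideal $I$ of $R$ and an $R$-module $M$, $\Gamma_I(M)=\{x\in M \mid I^n x=0 \text{ for some } n\geq 1\}$ and $(0:_M I)=\{x\in M\mid Ix=0\}$. A Serre subcategory $\mathcal{S}$ satisfies the Melkersson condition $(C_I)$ if: for every $R$-module $M$, if $\Gamma_I(M)=M$ and $(0:_M I)\in\mathcal{S}$, then $M\in\mathcal{S}$. Put $\mathbb{M}[\mathcal{S}]=\{\mathfrak{p}\in\mathrm{Spec}(R)\mid \mathcal{S}\text{ satisfies }(C_{\mathfrak{p}})\}$. *)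

(* Defs.v *)
From HB Require Import structures.
From mathcomp Require Import all_boot all_order all_algebra.
From mathcomp Require Import boolp classical_sets.

Set Implicit Arguments.
Unset Strict Implicit.
Unset Printing Implicit Defensive.

Import GRing.Theory.
Local Open Scope classical_set_scope.
Local Open Scope ring_scope.

Definition ideal (R : comNzRingType) (I : set R) : Prop :=
  submod_closed ([in I] : {pred R^o}).

(* [idealr_closed] includes properness: 1 \notin I. *)
Definition proper_ideals (R : comNzRingType) : set (set R) :=
  [set I | idealr_closed [in I]].
Arguments proper_ideals R _ : clear implicits.

Definition Spec (R : comNzRingType) : set (set R) :=
  [set p | proper_ideals R p /\ prime_idealr_closed [in p]].
Arguments Spec R _ : clear implicits.

Definition minimal_primes (R : comNzRingType) : set (set R) :=
  [set p | Spec R p /\ forall q, Spec R q -> q `<=` p -> q = p].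
Arguments minimal_primes R _ : clear implicits.

Definition maximal_ideals (R : comNzRingType) : set (set R) :=
  [set m | proper_ideals R m /\
           forall I, proper_ideals R I -> m `<=` I -> I = m].
Arguments maximal_ideals R _ : clear implicits.

Definition local_ring (R : comNzRingType) : Prop :=
  exists! m, maximal_ideals R m.

Definition ideal_gen (R : comNzRingType) (s : seq R) : set R :=
  [set x | exists c : 'I_(size s) -> R, x = \sum_(i < size s) c i * s`_i].

Definition noetherian_ring (R : comNzRingType) : Prop :=
  forall I : set R, ideal I -> exists s : seq R, I = ideal_gen s.

(* There is a chain p_0 < p_1 < ... < p_k of prime ideals; the values of the
   sequence beyond index k are irrelevant. *)
Definition has_prime_chain (R : comNzRingType) (k : nat) : Prop :=
  exists p : nat -> set R,
    (forall i, (i <= k)%N -> Spec R (p i)) /\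
    (forall i, (i < k)%N -> p i `<` p i.+1).

Definition krull_dim_le (R : comNzRingType) (n : nat) : Prop :=
  forall k, has_prime_chain R k -> (k <= n)%N.

Definition ideal_mul (R : comNzRingType) (I J : set R) : set R :=
  [set x | exists (n : nat) (a b : 'I_n -> R),
     (forall i, I (a i) /\ J (b i)) /\ x = \sum_(i < n) a i * b i].

Definition ideal_exp (R : comNzRingType) (I : set R) (n : nat) : set R :=
  iter n (ideal_mul I) setT.

Definition ann_set (R : comNzRingType) (M : lmodType R) (I : set R) : set M :=
  [set x | forall a, I a -> a *: x = 0].
Arguments ann_set {R} M I _.

Definition Gamma (R : comNzRingType) (M : lmodType R) (I : set R) : set M :=
  [set x | exists2 n : nat, (1 <= n)%N & ann_set M (ideal_exp I n) x].
Arguments Gamma {R} M I _.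

(* The submodule (0 :_M I), as an R-module in its own right. *)
Definition ann_pred (R : comNzRingType) (M : lmodType R) (I : set R) :
  {pred M} := [in ann_set M I].
Arguments ann_pred {R} M I _.

Lemma ann_submod_closed (R : comNzRingType) (M : lmodType R) (I : set R) :
  submod_closed (ann_pred M I).
Proof.
split=> [|b x y]; first by rewrite inE => a _; rewrite scaler0.
rewrite !inE => Ix Iy a Ia.
by rewrite scalerDr scalerA mulrC -scalerA Ix // Iy // scaler0 addr0.
Qed.

HB.instance Definition _ (R : comNzRingType) (M : lmodType R) (I : set R) :=
  GRing.isSubmodClosed.Build R M (ann_pred M I) (ann_submod_closed M I).

Record ann (R : comNzRingType) (M : lmodType R) (I : set R) := Ann
  { ann_val :> M; _ : ann_val \in ann_pred M I }.

HB.instance Definition _ (R : comNzRingType) (M : lmodType R) (I : set R) :=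
  [isSub for @ann_val R M I].
HB.instance Definition _ (R : comNzRingType) (M : lmodType R) (I : set R) :=
  [Choice of ann M I by <:].
HB.instance Definition _ (R : comNzRingType) (M : lmodType R) (I : set R) :=
  [SubChoice_isSubLmodule of ann M I by <:].

(* A full subcategory of R-Mod is given by its class of objects.  Closure under
   isomorphisms is a special case of [serre_sub] (or [serre_quo]), because
   sub- and quotient modules are given up to isomorphism there. *)
Record serre (R : comNzRingType) (S : lmodType R -> Prop) : Prop := Serre {
  serre_nonempty : exists M : lmodType R, S M;
  serre_sub : forall (L M : lmodType R) (f : {linear L -> M}),
    injective f -> S M -> S L;
  serre_quo : forall (M N : lmodType R) (g : {linear M -> N}),
    (forall z, exists y, g y = z) -> S M -> S N;
  serre_ext : forall (L M N : lmodType R)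
      (f : {linear L -> M}) (g : {linear M -> N}),
    injective f -> (forall y, g y = 0 <-> exists x, f x = y) ->
    (forall z, exists y, g y = z) -> S L -> S N -> S M }.

Definition melkersson (R : comNzRingType) (S : lmodType R -> Prop)
    (I : set R) : Prop :=
  forall M : lmodType R, Gamma M I = setT -> S (ann M I) -> S M.

Definition melkersson_primes (R : comNzRingType) (S : lmodType R -> Prop) :
    set (set R) :=
  [set p | Spec R p /\ melkersson S p].

(* Main.v *)
Require Import Defs.
From HB Require Import structures.
From mathcomp Require Import all_boot all_order all_algebra.
From mathcomp Require Import boolp classical_sets.

(* If [R] is local of dimension at most one with maximal ideal [m], then [C_m]
   implies [C_p] for every minimal prime [p]: some [t] outside [p] kills a power
   of [p], so multiplication by [t] exhibits a [p]-torsion module as an extension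
   of a module killed by a power of [p] by an [m]-torsion module.  If [C_p] and
   [C_q] hold for two distinct minimal primes, then [C_m] holds because [p + q]
   is [m]-primary.  This gives the trichotomy.

   Conversely, let [p0 < p1 < p2] be primes, [x] in [p1 \ p0], and let [p]
   inside [p1] be a minimal prime over [p0 + (x)].  The modules [N] such that
   [N_p] is noetherian over [R_p] form a Serre subcategory, which satisfies [C_m]
   because [m]-torsion modules vanish at [p].  It fails [C_p] on the [p]-torsion
   part of [A[1/x] / A], where [A = R / p0]: there [(0 : p)] lies in the cyclic
   module [x^-1 A / A], but the chain of the [(0 : x^i)] does not stabilize at
   [p]. *)

Set Implicit Arguments.
Unset Strict Implicit.
Unset Printing Implicit Defensive.

Import GRing.Theory.
Local Open Scope classical_set_scope.
Local Open Scope ring_scope.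

(** * Ideals, multiplicative sets and primes *)

Section Ideals.
Variable R : comNzRingType.
Implicit Types (I J p q U : set R) (a x y : R).

Lemma idealP J :
  ideal J <-> J 0 /\ (forall a x y, J x -> J y -> J (a * x + y)).
Proof.
split=> [[]|[J0 JD]]; rewrite ?inE.
  move=> J0 JD; split=> // a x y Jx Jy.
  by have := JD a x y; rewrite !inE; apply.
by split; rewrite ?inE // => a x y; rewrite !inE; apply: JD.
Qed.

Lemma ideal_prop0 J : ideal J -> J 0.
Proof. by case/idealP. Qed.

Lemma ideal_propM J a x : ideal J -> J x -> J (a * x).
Proof. by case/idealP=> J0 JD Jx; rewrite -[_ * _]addr0; apply: JD. Qed.

Lemma ideal_propMr J a x : ideal J -> J x -> J (x * a).
Proof. by rewrite mulrC; apply: ideal_propM. Qed.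

Lemma ideal_propD J x y : ideal J -> J x -> J y -> J (x + y).
Proof. by case/idealP=> J0 JD Jx Jy; rewrite -[x]mul1r; apply: JD. Qed.

Lemma proper_idealsP J : proper_ideals R J <-> ideal J /\ ~ J 1.
Proof.
split=> [[]|[/idealP[J0 JD] J1]]; rewrite ?inE.
  move=> J0 /negP J1 JD; split; last by move: J1; rewrite inE.
  by apply/idealP; split=> // a x y Jx Jy; have := JD a x y; rewrite !inE; apply.
split; rewrite ?inE //; first by apply/negP; rewrite inE.
by move=> a x y; rewrite !inE; apply: JD.
Qed.

Lemma SpecP p :
  Spec R p <-> [/\ ideal p, ~ p 1 & forall x y, p (x * y) -> p x \/ p y].
Proof.
split=> [[/proper_idealsP[idp p1] pM]|[idp p1 pM]].
  split=> // x y pxy; have := pM x y.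
  by rewrite !inE => /(_ pxy)/orP[]; rewrite inE; [left|right].
split; first exact/proper_idealsP.
by move=> x y; rewrite !inE => /pM[] ?; apply/orP; rewrite !inE; [left|right].
Qed.

Lemma Spec_ideal p : Spec R p -> ideal p.
Proof. by case/SpecP. Qed.

Lemma primeX p x n : Spec R p -> p (x ^+ n) -> p x.
Proof.
case/SpecP=> _ p1 pM; elim: n => [|n IHn]; first by rewrite expr0.
by rewrite exprS => /pM[].
Qed.

Lemma prime_notM p x y : Spec R p -> ~ p x -> ~ p y -> ~ p (x * y).
Proof. by case/SpecP=> _ _ pM px py /pM[]. Qed.

Lemma ideal_zero : ideal [set (0 : R)].
Proof. by apply/idealP; split=> // a x y -> ->; rewrite mulr0 addr0. Qed.

Definition ideal_adjoin J x : set R :=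
  [set z | exists a, exists2 y, J y & z = a * x + y].

Lemma ideal_adjoin_ideal J x : ideal J -> ideal (ideal_adjoin J x).
Proof.
move=> idJ; apply/idealP; split.
  by exists 0, 0; rewrite ?mul0r ?addr0 //; apply: ideal_prop0.
move=> c _ _ [a [u Ju ->]] [b [v Jv ->]]; exists (c * a + b), (c * u + v).
  by apply: ideal_propD => //; apply: ideal_propM.
by rewrite mulrDr mulrA mulrDl addrACA.
Qed.

Lemma sub_ideal_adjoin J x : J `<=` ideal_adjoin J x.
Proof. by move=> y Jy; exists 0, y; rewrite // mul0r add0r. Qed.

Lemma mem_ideal_adjoin J x : ideal J -> ideal_adjoin J x x.
Proof.
by move=> idJ; exists 1, 0; rewrite ?mul1r ?addr0 //; apply: ideal_prop0.
Qed.

Lemma exists_max_ideal_disjoint J U :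
    ideal J -> (forall x, J x -> ~ U x) ->
  exists q, [/\ ideal q, J `<=` q, (forall x, q x -> ~ U x) &
    forall q', ideal q' -> q `<=` q' -> (forall x, q' x -> ~ U x) -> q' = q].
Proof.
move=> idJ JU.
pose good q := [/\ ideal q, J `<=` q & forall x, q x -> ~ U x].
(* The empty set is added to the family because it is the union of the empty chain. A maximal member
   cannot be empty, since [J] is good and contains [0]. *)
have [F FP Ftot|q [Pq qmax]] := @Zorn_bigcup R [set q | q = set0 \/ good q].
  have [[A [FA gA]]|noF] := pselect (exists X, F X /\ good X); last first.
    left; rewrite -subset0 => x [X FX Xx].
    by case: (FP _ FX) => [X0|gX]; [rewrite -X0 | case: noF; exists X].
  have gF X x : F X -> X x -> good X.
    by move=> FX Xx; case: (FP _ FX) => // X0; rewrite X0 in Xx.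
  right; split; last by move=> x [X FX Xx]; case: (gF _ _ FX Xx) => _ _; apply.
    apply/idealP; split; first by exists A => //; case: gA => /ideal_prop0.
    move=> a x y [X FX Xx] [Y FY Yy].
    have [idX _ _] := gF _ _ FX Xx; have [idY _ _] := gF _ _ FY Yy.
    case: (Ftot X Y FX FY) => XY; [exists Y|exists X] => //.
      by apply: ideal_propD => //; apply: ideal_propM => //; apply: XY.
    by apply: ideal_propD; [| apply: ideal_propM | apply: XY].
  by move=> x Jx; exists A => //; case: gA => _ + _; apply.
have gJ : good J by split.
have [q0|[idq Jq qU]] : q = set0 \/ good q by exact: Pq.
  exfalso; apply: (qmax J); last by right.
  rewrite q0; split; first exact: sub0set.
  by move=> /(_ 0); apply; apply: ideal_prop0.
exists q; split=> // q' idq' qq' q'U; apply: contrapT => q'q.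
apply: (qmax q'); last by right; split=> //; apply: subset_trans qq'.
by split=> // q'_q; apply: q'q; apply/seteqP.
Qed.

Definition mul_closed_set U := U 1 /\ forall x y, U x -> U y -> U (x * y).

(** An ideal [q] maximal among those avoiding [U] is prime: for [x], [y] outside [q], both [q + (x)]
    and [q + (y)] meet [U], and if [x * y] were in [q], the product of the two common elements would
    lie in [q] and in [U]. *)
Lemma exists_prime_disjoint J U :
    ideal J -> mul_closed_set U -> (forall x, J x -> ~ U x) ->
  exists q, [/\ Spec R q, J `<=` q & forall x, q x -> ~ U x].
Proof.
move=> idJ [U1 UM] JU.
have [q [idq Jq qU qmax]] := exists_max_ideal_disjoint idJ JU.
exists q; split=> //; apply/SpecP; split=> // [/qU//|x y qxy].
have meets z : ~ q z -> exists2 w, ideal_adjoin q z w & U w.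
  move=> qz; apply: contrapT => h; apply: qz.
  rewrite -(qmax (ideal_adjoin q z)) //.
  - exact: mem_ideal_adjoin.
  - exact: ideal_adjoin_ideal.
  - exact: sub_ideal_adjoin.
  by move=> w qw Uw; apply: h; exists w.
apply: contrapT => /not_orP[/meets[_ [a [u qu ->]] Uu]].
move=> /meets[_ [b [v qv ->]] Uv].
apply: qU (UM _ _ Uu Uv).
have -> : (a * x + u) * (b * y + v)
    = a * b * (x * y) + ((a * x) * v + (b * y + v) * u).
  by rewrite mulrDl mulrDr (mulrACA a) [u * _]mulrC addrA.
apply: ideal_propD => //; first exact: ideal_propM.
by apply: ideal_propD => //; apply: ideal_propM.
Qed.

Lemma mul_closed_powers y : mul_closed_set [set x | exists n, x = y ^+ n].
Proof.
split; first by exists 0%N; rewrite expr0.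
by move=> _ _ [i ->] [j ->]; exists (i + j)%N; rewrite exprD.
Qed.

(** If [J] avoided all powers of [y], it would extend to a prime avoiding them. *)
Lemma pow_in_ideal J y :
    ideal J -> (forall q, Spec R q -> J `<=` q -> q y) ->
  exists n, J (y ^+ n).
Proof.
move=> idJ qy; apply: contrapT => h.
have [|q [Sq Jq qU]] := exists_prime_disjoint idJ (mul_closed_powers y).
  by move=> x Jx [n xE]; rewrite xE in Jx; apply: h; exists n.
by apply: (qU y (qy _ Sq Jq)); exists 1%N; rewrite expr1.
Qed.

(* [p] is the complement of a maximal multiplicative set containing the
   complement of [p1] and avoiding [J]; it is thus minimal over [J]. *)
Lemma exists_min_prime_over J p1 :
    ideal J -> Spec R p1 -> J `<=` p1 ->
  exists p, [/\ Spec R p, J `<=` p, p `<=` p1 &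
    forall y, p y -> exists s n, ~ p s /\ J (s * y ^+ n)].
Proof.
move=> idJ Sp1 Jp1.
pose good U := [/\ mul_closed_set U, ~` p1 `<=` U & forall x, J x -> ~ U x].
have gp1 : good (~` p1).
  split=> [|//|x /Jp1 ? //]; split; first by case/SpecP: Sp1.
  by move=> x y; apply: prime_notM.
have [F FP Ftot|U [PU Umax]] := @Zorn_bigcup R [set U | U = set0 \/ good U].
  have [[A [FA gA]]|noF] := pselect (exists X, F X /\ good X); last first.
    left; rewrite -subset0 => x [X FX Xx].
    by case: (FP _ FX) => [X0|gX]; [rewrite -X0 | case: noF; exists X].
  have gF X x : F X -> X x -> good X.
    by move=> FX Xx; case: (FP _ FX) => // X0; rewrite X0 in Xx.
  right; split; last first.
  - by move=> x Jx [X FX Xx]; case: (gF _ _ FX Xx) => _ _ /(_ _ Jx).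
  - by move=> x p1x; exists A => //; case: gA => _ + _; apply.
  split; first by exists A => //; case: gA => -[].
  move=> x y [X FX Xx] [Y FY Yy].
  have [[_ XM] _ _] := gF _ _ FX Xx; have [[_ YM] _ _] := gF _ _ FY Yy.
  by case: (Ftot X Y FX FY) => XY; [exists Y|exists X] => //;
    [apply: YM => //; apply: XY | apply: XM => //; apply: XY].
have {PU} [[U1 UM] p1U JU] : good U.
  have [U0|//] : U = set0 \/ good U by exact: PU.
  exfalso; apply: (Umax (~` p1)); last by right.
  rewrite U0; split; first exact: sub0set.
  by move=> /(_ 1); apply; case/SpecP: Sp1.
have {}Umax V : good V -> U `<=` V -> V `<=` U.
  by move=> gV UV; apply: contrapT => nVU; apply: (Umax V); [split|right].
have [q [Sq Jq qU]] := exists_prime_disjoint idJ (conj U1 UM) JU.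
(* The complement of [q] is itself good and contains [U], so maximality makes it equal to [U]. *)
have qcU : ~` q `<=` U.
  apply: Umax => [|x Ux qx]; last exact: qU Ux.
  split=> [|x p1x qx|x /Jq ? //]; last by apply: qU qx _; apply: p1U.
  split; first by case/SpecP: Sq.
  by move=> x y; apply: prime_notM.
exists q; split=> // [x qx|y qy].
  by apply: contrapT => p1x; apply: (qU _ qx); apply: p1U.
apply: contrapT => h; apply: (qU _ qy).
(* The multiplicative set generated by [U] and [y] would still avoid [J], so maximality would put
   [y] into [U], although [y] is in [q]. *)
apply: (Umax [set z | exists s n, U s /\ z = s * y ^+ n]); last first.
- by exists 1, 1%N; rewrite mul1r expr1.
- by move=> s Us; exists s, 0%N; rewrite expr0 mulr1.
split.
- split; first by exists 1, 0%N; rewrite expr0 mulr1.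
  move=> _ _ [s [i [Us ->]]] [t [j [Ut ->]]].
  by exists (s * t), (i + j)%N; rewrite exprD mulrACA; split=> //; apply: UM.
- by move=> s p1s; exists s, 0%N; rewrite expr0 mulr1; split=> //; apply: p1U.
- move=> z Jz [s [n [Us zE]]]; apply: h; exists s, n; rewrite -zE; split=> //.
  by move=> /qU.
Qed.

Lemma min_prime_pow p y :
  minimal_primes R p -> p y -> exists s n, ~ p s /\ s * y ^+ n = 0.
Proof.
move=> [Sp pmin] py.
have [|q [Sq _ qp hq]] := exists_min_prime_over ideal_zero Sp.
  by move=> _ ->; apply: ideal_prop0; apply: Spec_ideal.
by move: hq; rewrite (pmin q Sq qp) => /(_ _ py).
Qed.

(** An ideal maximal among those containing [p] and avoiding [1] is a maximal ideal, hence equals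
    [m]. *)
Lemma local_prime_sub m p :
  local_ring R -> maximal_ideals R m -> Spec R p -> p `<=` m.
Proof.
move=> [m' [_ uniq]] mm Sp; have [idp p1 _] := (SpecP p).1 Sp.
have [|q [idq pq q1 qmax]] := @exists_max_ideal_disjoint p [set 1] idp.
  by move=> x px xE; rewrite xE in px.
suff qm : maximal_ideals R q by rewrite (_ : m = q) // -(uniq _ mm) -(uniq _ qm).
split; first by apply/proper_idealsP; split=> // q_1; apply: (q1 1).
move=> I /proper_idealsP[idI I1] qI; apply: qmax => //.
by move=> x Ix xE; rewrite xE in Ix.
Qed.

Lemma maximal_prime m : maximal_ideals R m -> Spec R m.
Proof.
move=> [/proper_idealsP[idm m1] mmax].
have [||q [Sq mq _]] := @exists_prime_disjoint m [set 1] idm.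
- by split=> // x y -> ->; rewrite mulr1.
- by move=> x mx xE; rewrite xE in mx.
by rewrite -(mmax q) //; case: Sq.
Qed.

End Ideals.

(** * Torsion with respect to an ideal *)

Section Torsion.
Variables (R : comNzRingType) (M : lmodType R).
Implicit Types (I : set R) (z : M).

Lemma ann_set0 I : ann_set M I 0.
Proof. by move=> a _; rewrite scaler0. Qed.

Lemma ann_setP I a x y :
  ann_set M I x -> ann_set M I y -> ann_set M I (a *: x + y).
Proof.
by have [_ h] := ann_submod_closed M I; have := h a x y; rewrite !inE.
Qed.

Lemma ann_expS I n z : ann_set M (ideal_exp I n.+1) z <->
  forall a, I a -> ann_set M (ideal_exp I n) (a *: z).
Proof.
split=> [h a Ia b Ib|h _ [k [a [b [Iab ->]]]]].
  rewrite scalerA mulrC; apply: h.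
  by exists 1%N, (fun=> a), (fun=> b); rewrite big_ord1.
rewrite scaler_suml big1 // => i _.
by rewrite mulrC -scalerA; apply: h; case: (Iab i).
Qed.

Lemma ann_exp0 I z : ann_set M (ideal_exp I 0) z -> z = 0.
Proof. by move/(_ 1 Logic.I); rewrite scale1r. Qed.

(** Induction on the sum of the exponents: multiplying [z] by the [i]-th generator lowers [e i] by
    one, and [e i = 0] means that [z] vanishes. The extra power covers the empty [s], where the sum
    is [0] but [z] is arbitrary. *)
Lemma ann_exp_gen (s : seq R) (e : 'I_(size s) -> nat) z :
  (forall i : 'I_(size s), s`_i ^+ e i *: z = 0) ->
  ann_set M (ideal_exp (ideal_gen s) (\sum_i e i)%N.+1) z.
Proof.
move: {2}(\sum_i e i)%N (erefl (\sum_i e i)%N) => n.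
elim: n e z => [|n IHn] e z sumE ez; apply/ann_expS => _ [c ->].
all: rewrite scaler_suml; apply: big_ind => [|x y hx hy|i _];
  [exact: ann_set0 | by rewrite -[x]scale1r; exact: ann_setP |].
  have /eqP := sumE; rewrite sum_nat_eq0 => /forallP/(_ i)/= /eqP ei.
  by have := ez i; rewrite ei expr0 scale1r => ->; rewrite scaler0; exact: ann_set0.
rewrite -scalerA -[_ *: _]addr0; refine (ann_setP _ _ (@ann_set0 _)).
case ei: (e i) => [|k].
  by have := ez i; rewrite ei expr0 scale1r => ->; rewrite scaler0; exact: ann_set0.
pose e' j := if j == i then k else e j.
have sumE' : (\sum_j e' j = n)%N.
  move: sumE; rewrite (bigD1 i) //= ei addSn => -[<-].
  rewrite (bigD1 i) //= /e' eqxx.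
  by congr addn; apply: eq_bigr => j /negPf->.
rewrite sumE -sumE'; apply: IHn => // j; rewrite /e'.
case: eqP => [->|_]; first by rewrite scalerA -exprSr -ei.
by rewrite scalerA mulrC -scalerA ez scaler0.
Qed.

Lemma Gamma_gen (s : seq R) z :
  (forall a, a \in s -> exists n, a ^+ n *: z = 0) -> Gamma M (ideal_gen s) z.
Proof.
move=> h; have /choice[e ez] : forall i : 'I_(size s), exists n, s`_i ^+ n *: z = 0.
  by move=> i; apply: h; apply: mem_nth.
by exists (\sum_i e i)%N.+1 => //; apply: ann_exp_gen.
Qed.

Lemma Gamma_pow I y z : Gamma M I z -> I y -> exists n, y ^+ n *: z = 0.
Proof.
move=> [n _ +] Iy; elim: n z => [|n IHn] z.
  by move/ann_exp0=> ->; exists 0%N; rewrite scaler0.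
move/ann_expS=> /(_ y Iy)/IHn[k h]; exists k.+1.
by rewrite exprSr -scalerA.
Qed.

End Torsion.

Lemma ideal_gen_mem (R : comNzRingType) (s : seq R) a :
  a \in s -> ideal_gen s a.
Proof.
move=> /(nthP 0)[i lti <-]; exists (fun j => (j == Ordinal lti)%:R).
rewrite (bigD1 (Ordinal lti)) //= eqxx mul1r big1 ?addr0 // => j /negPf->.
by rewrite mul0r.
Qed.

(** * Submodules and Serre subcategories *)

(** Kept as a predicate on [M], so that submodules can be compared and intersected inside [M];
    [subm] makes one a module. *)
Record submod (R : comNzRingType) (M : lmodType R) := Submod {
  submod_set :> M -> Prop;
  submod_subproof : submod_closed [in (submod_set : set M)] }.

Definition submod_pred (R : comNzRingType) (M : lmodType R) (P : submod M) :
  {pred M} := [in (submod_set P : set M)].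

HB.instance Definition _ (R : comNzRingType) (M : lmodType R) (P : submod M) :=
  GRing.isSubmodClosed.Build R M (submod_pred P) (submod_subproof P).

Record subm (R : comNzRingType) (M : lmodType R) (P : submod M) := Subm
  { subm_val :> M; _ : subm_val \in submod_pred P }.

HB.instance Definition _ (R : comNzRingType) (M : lmodType R) (P : submod M) :=
  [isSub for @subm_val R M P].
HB.instance Definition _ (R : comNzRingType) (M : lmodType R) (P : submod M) :=
  [Choice of subm P by <:].
HB.instance Definition _ (R : comNzRingType) (M : lmodType R) (P : submod M) :=
  [SubChoice_isSubLmodule of subm P by <:].

Section Submodules.
Variables (R : comNzRingType) (M : lmodType R).
Implicit Types (P Q : submod M).

Lemma subm_valP P (z : subm P) : P (val z).
Proof. by case: z => z /= Pz; move: Pz; rewrite !inE. Qed.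

Definition to_subm P z (Pz : P z) : subm P := Subm (mem_set Pz).

Lemma submod0 P : P 0.
Proof. by have [] := submod_subproof P; rewrite inE. Qed.

Lemma submodP P a x y : P x -> P y -> P (a *: x + y).
Proof.
move=> Px Py; have [_ h] := submod_subproof P.
by have := h a x y; rewrite !inE; apply.
Qed.

Lemma submodZ P a x : P x -> P (a *: x).
Proof. by move=> Px; rewrite -[_ *: _]addr0; apply: submodP (submod0 P). Qed.

Lemma submodB P x y : P x -> P y -> P (x - y).
Proof. by move=> Px Py; rewrite addrC -scaleN1r; apply: submodP. Qed.

Definition mk_submod (A : set M) (A0 : A 0)
  (AP : forall a x y, A x -> A y -> A (a *: x + y)) : submod M.
Proof.
exists A; split; first by rewrite inE.
by move=> a x y; rewrite !inE; apply: AP.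
Defined.

Definition submodT : submod M.
Proof. by apply: (@mk_submod setT). Defined.

Definition submod_ann (I : set R) : submod M :=
  mk_submod (@ann_set0 _ M I) (@ann_setP _ M I).

Definition submodI P Q : submod M.
Proof.
apply: (@mk_submod [set z | P z /\ Q z]).
  by split; apply: submod0.
by move=> a x y [Px Qx] [Py Qy]; split; apply: submodP.
Defined.

Definition submod_mul (b : R) P : submod M.
Proof.
apply: (@mk_submod [set z | exists2 x, P x & z = b *: x]).
  by exists 0; [apply: submod0 | rewrite scaler0].
move=> a _ _ [x Px ->] [y Py ->]; exists (a *: x + y); first exact: submodP.
by rewrite scalerDr !scalerA mulrC.
Defined.

End Submodules.
Arguments submodT {R} M.
Arguments submod_ann {R} M I.

Section Serre.
Variables (R : comNzRingType) (S : lmodType R -> Prop).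
Hypothesis Sserre : serre S.

Lemma serre_embed (M N : lmodType R) (P : submod M) (f : N -> M) :
    linear f -> injective f -> (forall x, P (f x)) -> S (subm P) -> S N.
Proof.
move=> flin finj fP; pose g x := to_subm (fP x).
have glin : linear g by move=> a x y; apply: val_inj; rewrite /= flin.
pose G : {linear N -> subm P} := HB.pack g (GRing.isLinear.Build R N (subm P) _ g glin).
by apply: (serre_sub Sserre (f := G)) => x y /(congr1 val) /finj.
Qed.

(** A choice of preimages is linear because [f] is injective, and it embeds [P] in [N]. *)
Lemma serre_range (M N : lmodType R) (P : submod M) (f : N -> M) :
    linear f -> injective f -> (forall z, P z -> exists x, f x = z) ->
  S N -> S (subm P).
Proof.
move=> flin finj fP.
have /choice[g gK] : forall z : subm P, exists x, f x = val z.
  by move=> z; apply: fP; apply: subm_valP.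
have glin : linear g by move=> a x y; apply: finj; rewrite flin !gK.
pose G : {linear subm P -> N} := HB.pack g (GRing.isLinear.Build R (subm P) N _ g glin).
apply: (serre_sub Sserre (f := G)) => x y /(congr1 f).
by rewrite /= !gK => /val_inj.
Qed.

Section InModule.
Variable M : lmodType R.
Implicit Types P Q K : submod M.

Lemma serre_incl P Q : (forall z, P z -> Q z) -> S (subm Q) -> S (subm P).
Proof.
move=> PQ; apply: serre_embed (val : subm P -> M) _ val_inj _ => //.
by move=> z; apply/PQ/subm_valP.
Qed.

Lemma serre_submodT : S (subm (submodT M)) -> S M.
Proof. by apply: (@serre_embed M M (submodT M) id). Qed.

(* The exact sequence [0 -> (0 :_P a) -> P -> aP -> 0]. *)
Lemma serre_mul P Q (a : R) :
    (forall z, P z -> Q (a *: z)) ->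
  S (subm (submodI P (submod_ann M [set a]))) -> S (subm Q) -> S (subm P).
Proof.
move=> aPQ SK SQ; set K := submodI _ _ in SK.
have {SQ} SaP : S (subm (submod_mul a P)).
  by apply: (serre_incl _ SQ) => _ [x Px ->]; apply: aPQ.
have fP (x : subm K) : P (val x) by case: (subm_valP x).
have gP (x : subm P) : submod_mul a P (a *: val x).
  by exists (val x) => //; apply: subm_valP.
pose f x := to_subm (fP x); pose g x := to_subm (gP x).
have flin : linear f by move=> b x y; apply: val_inj.
have glin : linear g.
  by move=> b x y; apply: val_inj; rewrite /= scalerDr !scalerA mulrC.
pose F : {linear subm K -> subm P} :=
  HB.pack f (GRing.isLinear.Build R (subm K) (subm P) _ f flin).
pose G : {linear subm P -> subm (submod_mul a P)} :=
  HB.pack g (GRing.isLinear.Build R (subm P) (subm (submod_mul a P)) _ g glin).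
apply: (serre_ext Sserre (f := F) (g := G)) => //.
- by move=> x y /(congr1 val) /= /val_inj.
- move=> y; split=> [/(congr1 val)/= ay0|[x <-]].
    have Ky : K (val y) by split; [apply: subm_valP | move=> _ ->].
    by exists (to_subm Ky); apply: val_inj.
  by apply: val_inj; case: (subm_valP x) => _ /(_ a erefl).
- move=> z; have [x Px xE] := subm_valP z.
  by exists (to_subm Px); apply: val_inj; rewrite /= -xE.
Qed.

(** [serre_mul] is iterated along [s], each step cutting [P] down to the kernel of one more
    element. *)
Lemma serre_mul_seq (s : seq R) P Q :
    (forall a z, a \in s -> P z -> Q (a *: z)) ->
    S (subm (submodI P (submod_ann M [set a | a \in s]))) -> S (subm Q) ->
  S (subm P).
Proof.
move=> + + SQ; elim: s P => [|a s IHs] P sPQ SK.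
  by apply: (serre_incl _ SK) => z Pz; split.
apply: (serre_mul (a := a) _ _ SQ) => [z|]; first by apply: sPQ; rewrite mem_head.
apply: IHs => [b z bs [Pz _]|].
  by apply: sPQ => //; rewrite in_cons bs orbT.
apply: (serre_incl _ SK) => z [[Pz az] sz]; split=> // b /=.
by rewrite in_cons => /orP[/eqP->|]; [apply: az | apply: sz].
Qed.

(** With [I] generated by [s], each generator maps [(0 : I^(n+1))] into [(0 : I^n)], and the common
    kernel of the generators lies in [(0 : I)]. *)
Lemma serre_ann_exp (s : seq R) n :
    S (subm (submod_ann M (ideal_gen s))) ->
  S (subm (submod_ann M (ideal_exp (ideal_gen s) n))).
Proof.
move=> S1; elim: n => [|n IHn].
  by apply: (serre_incl _ S1) => z /ann_exp0 ->; apply: submod0.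
apply: (serre_mul_seq (s := s) _ _ IHn) => [a z /ideal_gen_mem sa /ann_expS|].
  by apply.
apply: (serre_incl _ S1) => z [_ sz] _ [c ->].
rewrite scaler_suml big1 // => i _.
by rewrite -scalerA sz ?scaler0 //=; apply: mem_nth.
Qed.

(** Carries the condition over to a submodule [P], with [(0 :_P p)] computed inside [M]. *)
Lemma melkersson_submod (p : set R) P :
    melkersson S p -> (forall z, P z -> Gamma M p z) ->
  S (subm (submodI P (submod_ann M p))) -> S (subm P).
Proof.
move=> Sp PG SPp; apply: Sp.
  apply/seteqP; split=> // z _; have [n n1 zn] := PG _ (subm_valP z).
  by exists n => // a /zn az; apply: val_inj.
apply: (serre_embed (f := fun x : ann (subm P) p => val (val x))) SPp => //.
  by move=> x y /val_inj/val_inj.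
move=> x; split; first exact: subm_valP.
have /set_mem xp : val x \in ann_pred (subm P) p by case: x.
by move=> a /xp/(congr1 val).
Qed.

End InModule.
End Serre.

(** Finite generation of [I] turns separate exponents for its elements into one power of [I]. *)
Lemma Gamma_noetherian (R : comNzRingType) (M : lmodType R) (I : set R) (z : M) :
    noetherian_ring R -> ideal I ->
  (forall y, I y -> exists n, y ^+ n *: z = 0) -> Gamma M I z.
Proof.
move=> Rnoeth idI h; have [s sE] := Rnoeth I idI; rewrite sE.
by apply: Gamma_gen => a /ideal_gen_mem sa; apply: h; rewrite sE.
Qed.

Lemma serre_ann (R : comNzRingType) (S : lmodType R -> Prop) (M : lmodType R)
  (I : set R) : serre S -> S (ann M I) -> S (subm (submod_ann M I)).
Proof.
move=> SS; apply: (serre_range SS (f := val : ann M I -> M)) => //.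
  exact: val_inj.
by move=> z Iz; exists (Ann (mem_set Iz)).
Qed.

(** * Rings of dimension at most one *)

Section DimOne.
Variables (R : comNzRingType) (m : set R).
Hypotheses (Rnoeth : noetherian_ring R) (Rlocal : local_ring R).
Hypotheses (Rdim : krull_dim_le R 1) (mm : maximal_ideals R m).
Implicit Types p q : set R.

Let Sm : Spec R m := maximal_prime mm.
Let Spec_le_m p : Spec R p -> p `<=` m := local_prime_sub Rlocal mm.

Lemma dim1_no_chain p q r :
  Spec R p -> Spec R q -> Spec R r -> p `<` q -> q `<` r -> False.
Proof.
move=> Sp Sq Sr pq qr.
suff /Rdim : has_prime_chain R 2 by [].
exists (fun i => if i is i'.+1 then if i' is _.+1 then r else q else p).
by split=> -[|[|[]]].
Qed.

Lemma dim1_minimal p : Spec R p -> p <> m -> minimal_primes R p.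
Proof.
move=> Sp pm; split=> // q Sq qp; apply: contrapT => q'p.
apply: (dim1_no_chain Sq Sp Sm); split=> //.
  by move=> pq; apply: q'p; apply/seteqP.
  exact: Spec_le_m.
by move=> mp; apply: pm; apply/seteqP; split=> //; apply: Spec_le_m.
Qed.

Lemma dim1_over p q : Spec R p -> p <> m -> Spec R q -> p `<=` q -> q <> p ->
  q = m.
Proof.
move=> Sp pm Sq pq qp; apply: contrapT => /(dim1_minimal Sq)[_ /(_ p Sp pq)].
by move=> pE; apply: qp.
Qed.

Section Closure.
Variable S : lmodType R -> Prop.
Hypothesis Sserre : serre S.

Lemma melkersson_of_maximal p : Spec R p -> melkersson S m -> melkersson S p.
Proof.
move=> Sp Cm; have [->//|pm] := pselect (p = m).
move=> M MG /(serre_ann Sserre) Sp1.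
have {}MG z : Gamma M p z by rewrite MG.
have idp := Spec_ideal Sp; have [s sE] := Rnoeth idp.
have sp (i : 'I_(size s)) : p s`_i by rewrite sE; apply/ideal_gen_mem/mem_nth.
(* [R_p] is Artinian: some [t] outside [p] kills a power of every generator
   of [p]. *)
have [t [e [pt te]]] : exists t (e : 'I_(size s) -> nat),
    ~ p t /\ forall i : 'I_(size s), s`_i ^+ e i * t = 0.
  have /choice[f fP] (i : 'I_(size s)) :
      exists te, ~ p te.1 /\ te.1 * s`_i ^+ te.2 = 0.
    have [t [n tn]] := min_prime_pow (dim1_minimal Sp pm) (sp i).
    by exists (t, n).
  exists (\prod_i (f i).1), (fun i => (f i).2); split.
    apply: (big_ind (fun x => ~ p x)) => [|x y|i _].
    - by case/SpecP: Sp.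
    - exact: prime_notM.
    by case: (fP i).
  by move=> i; rewrite (bigD1 i) //= mulrA (mulrC _ (f i).1) (fP i).2 mul0r.
apply: (serre_submodT Sserre).
apply: (serre_mul Sserre (a := t)
  (Q := submod_ann M (ideal_exp (ideal_gen s) (\sum_i e i).+1))).
- move=> z _; apply: ann_exp_gen => i.
  by rewrite scalerA te scale0r.
(* The kernel of [t] is [m]-torsion: the only prime over [p + (t)] is [m], so for [y] in [m] some
   [y ^+ n] is [a * t + u] with [u] in [p]. It acts on [z] as [u] does, and a power of [u] kills
   [z]. *)
- apply: (melkersson_submod Sserre Cm) => [z [_ tz]|].
    apply: Gamma_noetherian (Spec_ideal Sm) _ => // y my.
    have [|n [a [u pu yE]]] := pow_in_ideal (ideal_adjoin_ideal t idp) (y := y).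
      move=> q Sq Jq; rewrite (dim1_over Sp pm Sq) //.
        by apply: subset_trans Jq; apply: sub_ideal_adjoin.
      by move=> qp; apply: pt; rewrite -qp; apply/Jq/mem_ideal_adjoin.
    have yz : y ^+ n *: z = u *: z.
      by rewrite yE scalerDl -scalerA tz // scaler0 add0r.
    have [k uk] := Gamma_pow (MG z) pu; exists (n * k)%N; rewrite exprM.
    suff -> : y ^+ n ^+ k *: z = u ^+ k *: z by [].
    elim: k {uk} => [//|k IHk].
    by rewrite exprSr -scalerA yz scalerA mulrC -scalerA IHk scalerA -exprS.
  apply: (serre_incl Sserre _ Sp1) => z [_ mz] a pa.
  by apply: mz; apply: Spec_le_m pa.
- by apply: (serre_ann_exp Sserre); rewrite -sE.
Qed.

Lemma melkersson_maximal_of_two p q :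
    Spec R p -> Spec R q -> p <> m -> q <> m -> p <> q ->
  melkersson S p -> melkersson S q -> melkersson S m.
Proof.
move=> Sp Sq pm qm pq Cp Cq M MG /(serre_ann Sserre) Sm1.
have {}MG z r : Spec R r -> Gamma M r z.
  move=> Sr; apply: Gamma_noetherian (Spec_ideal Sr) _ => // y ry.
  have mz : Gamma M m z by rewrite MG.
  by apply: Gamma_pow mz _; apply: Spec_le_m ry.
have idp := Spec_ideal Sp; have idq := Spec_ideal Sq.
pose J : set R := [set w | exists u v, [/\ p u, q v & w = u + v]].
have idJ : ideal J.
  apply/idealP; split.
    by exists 0, 0; rewrite addr0; split=> //; apply: ideal_prop0.
  move=> a _ _ [u [v [pu qv ->]]] [u' [v' [pu' qv' ->]]].
  exists (a * u + u'), (a * v + v'); rewrite mulrDr addrACA; split=> //.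
    by apply: ideal_propD => //; apply: ideal_propM.
  by apply: ideal_propD => //; apply: ideal_propM.
(* A prime over [J = p + q] other than [m] would equal the minimal prime [p], and then contain,
   hence equal, [q]. *)
have Jm y : m y -> exists n, J (y ^+ n).
  move=> my; apply: pow_in_ideal => // r Sr Jr.
  have pr : p `<=` r.
    by move=> u pu; apply: Jr; exists u, 0; rewrite addr0; split=> //; apply: ideal_prop0.
  have qr : q `<=` r.
    by move=> v qv; apply: Jr; exists 0, v; rewrite add0r; split=> //; apply: ideal_prop0.
  rewrite (dim1_over Sp pm Sr pr) // => rp; apply: pq.
  by have [_ /(_ q Sq)->//] := dim1_minimal Sp pm; rewrite -rp.
have [s sE] := Rnoeth (Spec_ideal Sm).
have /choice[e eJ] (i : 'I_(size s)) : exists n, J (s`_i ^+ n).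
  by apply: Jm; rewrite sE; apply/ideal_gen_mem/mem_nth.
(* Elements killed by [p + q] are killed by a power of each generator of [m], hence by a fixed power
   of [m]. *)
have Spq : S (subm (submodI (submod_ann M p) (submod_ann M q))).
  rewrite sE in Sm1.
  apply: (serre_incl Sserre _ (serre_ann_exp Sserre (\sum_i e i).+1 Sm1)).
  move=> z [pz qz].
  apply: ann_exp_gen => i; have [u [v [pu qv ->]]] := eJ i.
  by rewrite scalerDl pz // qz // addr0.
(* The condition at [q] is used on [(0 :_M p)], then the one at [p] on [M]. *)
have {}Spq : S (subm (submod_ann M p)).
  by apply: (melkersson_submod Sserre Cq) => // z _; apply: MG.
apply: (serre_submodT Sserre); apply: (melkersson_submod Sserre Cp) => [z _|].
  exact: MG.
by apply: (serre_incl Sserre _ Spq) => z [].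
Qed.

(** If [C_m] holds, so does every [C_p]. If it fails, a prime with the condition differs from [m],
    so it is minimal, and two such primes would give [C_m] back. *)
Lemma melkersson_trichotomy :
  [\/ melkersson_primes S = Spec R,
      exists2 p : set R, minimal_primes R p & melkersson_primes S = [set p]
    | melkersson_primes S = set0].
Proof.
have [Cm|nCm] := pselect (melkersson S m).
  constructor 1; apply/seteqP; split=> [p []//|p Sp]; split=> //.
  exact: melkersson_of_maximal.
have [[p [Sp Cp]]|noC] := pselect (exists p, melkersson_primes S p); last first.
  by constructor 3; rewrite -subset0 => p Cp; apply: noC; exists p.
have notm q : melkersson S q -> q <> m by move=> Cq qm; apply: nCm; rewrite -qm.
constructor 2; exists p; first by apply: dim1_minimal => //; apply: notm.
apply/seteqP; split=> [q [Sq Cq]|_ ->//].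
apply: contrapT => qp; apply: nCm.
by apply: (melkersson_maximal_of_two Sq Sp) => //; apply: notm.
Qed.

End Closure.
End DimOne.

(** * Quotient modules *)

Section QuotientModule.
Variables (R : comNzRingType) (V : lmodType R) (P : submod V).

(** The quotient group, under a name to which the scalar action is attached below. *)
Definition quotm := Quotient.quot (submod_pred P).

HB.instance Definition _ := GRing.Zmodule.on quotm.

Local Open Scope quotient_scope.

Definition quotm_pi (x : V) : quotm := \pi_(Quotient.quot (submod_pred P)) x.

Lemma quotm_piB : {morph quotm_pi : x y / x - y}.
Proof. exact: (raddfB (\pi_(Quotient.quot (submod_pred P)))). Qed.

Lemma quotm_piD : {morph quotm_pi : x y / x + y}.
Proof. exact: (raddfD (\pi_(Quotient.quot (submod_pred P)))). Qed.

Lemma quotm_surj (z : quotm) : exists x, z = quotm_pi x.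
Proof. by exists (repr z); rewrite /quotm_pi reprK. Qed.

Lemma quotm_eq x y : quotm_pi x = quotm_pi y <-> P (x - y).
Proof.
rewrite /quotm_pi; split=> [/eqP|Pxy].
  by rewrite -Quotient.idealrBE inE.
by apply/eqP; rewrite -Quotient.idealrBE inE.
Qed.

Lemma quotm_eq0 x : quotm_pi x = 0 <-> P x.
Proof.
have <- : quotm_pi 0 = 0 by exact: (raddf0 (\pi_(Quotient.quot (submod_pred P)))).
by rewrite quotm_eq subr0.
Qed.

Definition quotm_scale (a : R) (z : quotm) : quotm :=
  quotm_pi (a *: repr (z : Quotient.quot (submod_pred P))).

Lemma quotm_scaleE a x : quotm_scale a (quotm_pi x) = quotm_pi (a *: x).
Proof.
apply/quotm_eq; rewrite -scalerBr; apply/submodZ/quotm_eq.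
by rewrite /quotm_pi reprK.
Qed.

Lemma quotm_scalerA a b z : quotm_scale a (quotm_scale b z) = quotm_scale (a * b) z.
Proof. by have [x ->] := quotm_surj z; rewrite !quotm_scaleE scalerA. Qed.

Lemma quotm_scale1r : left_id 1 quotm_scale.
Proof. by move=> z; have [x ->] := quotm_surj z; rewrite quotm_scaleE scale1r. Qed.

Lemma quotm_scalerDr : right_distributive quotm_scale +%R.
Proof.
move=> a z w; have [x ->] := quotm_surj z; have [y ->] := quotm_surj w.
by rewrite -quotm_piD !quotm_scaleE scalerDr quotm_piD.
Qed.

Lemma quotm_scalerDl z : {morph quotm_scale^~ z : a b / a + b}.
Proof.
move=> a b; have [x ->] := quotm_surj z.
by rewrite !quotm_scaleE scalerDl quotm_piD.
Qed.

HB.instance Definition _ := GRing.Zmodule_isLmodule.Build R quotm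
  quotm_scalerA quotm_scale1r quotm_scalerDr quotm_scalerDl.

Lemma quotm_piZ a x : quotm_pi (a *: x) = a *: quotm_pi x.
Proof. by rewrite -quotm_scaleE. Qed.

End QuotientModule.

(** * Modules that are noetherian at a prime *)

Section NoetherianAt.
Variable R : comNzRingType.

Lemma noetherian_chain (I : nat -> set R) :
    noetherian_ring R -> (forall i, ideal (I i)) ->
    (forall i j, (i <= j)%N -> I i `<=` I j) ->
  exists k, forall i, I i `<=` I k.
Proof.
move=> Rnoeth idI Imono.
have [|s sE] := Rnoeth (\bigcup_i I i).
  apply/idealP; split; first by exists 0%N => //; apply: ideal_prop0.
  move=> a x y [i _ Ix] [j _ Jy]; exists (maxn i j) => //.
  apply: ideal_propD => //; last by apply: Imono Jy; apply: leq_maxr.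
  by apply: ideal_propM => //; apply: Imono Ix; apply: leq_maxl.
have /choice[f fI] (j : 'I_(size s)) : exists i, I i s`_j.
  have [i _ Ii] : (\bigcup_i I i) s`_j by rewrite sE; apply/ideal_gen_mem/mem_nth.
  by exists i.
exists (\max_j f j)%N => i x Ix.
have [c ->] : ideal_gen s x by rewrite -sE; exists i.
apply: (big_ind (I (\max_j f j)%N)) => [|y z|j _]; first exact: ideal_prop0.
  exact: ideal_propD.
apply: ideal_propM => //; apply: Imono (fI j).
exact: (leq_bigmax_cond (P := predT) (F := f)).
Qed.

(* [N_p] is a noetherian [R_p]-module. *)
Definition noetherian_at (p : set R) (N : lmodType R) : Prop :=
  forall C : nat -> submod N, (forall i z, C i z -> C i.+1 z) ->
  exists k, forall i z, C i z -> exists s, ~ p s /\ C k (s *: z).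

Lemma submod_chain_le (N : lmodType R) (C : nat -> submod N) i j z :
  (forall i z, C i z -> C i.+1 z) -> (i <= j)%N -> C i z -> C j z.
Proof.
by move=> Cmono /subnK <- Cz; elim: (j - i)%N => // n IHn; apply: Cmono.
Qed.

Lemma noetherian_at_torsion (p : set R) (N : lmodType R) :
  (forall z : N, exists s, ~ p s /\ s *: z = 0) -> noetherian_at p N.
Proof.
move=> h C _; exists 0%N => i z _; have [s [ps sz]] := h z.
by exists s; split=> //; rewrite sz; apply: submod0.
Qed.

(** A chain in [N] is determined by the ideals of those [a] for which [a *: v] comes from it, and
    these stabilize in [R]. *)
Lemma noetherian_at_cyclic (p : set R) (N V : lmodType R)
    (g : {linear N -> V}) (v : V) :
    noetherian_ring R -> ~ p 1 -> injective g ->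
    (forall z, exists a, g z = a *: v) ->
  noetherian_at p N.
Proof.
move=> Rnoeth p1 ginj gv C Cmono.
pose I i : set R := [set a | exists2 z, C i z & g z = a *: v].
have [i|i j ij a [z Cz zE]|k Ik] := @noetherian_chain I Rnoeth.
- apply/idealP; split; first by exists 0; [apply: submod0 | rewrite raddf0 scale0r].
  move=> b x y [z Cz zE] [w Cw wE]; exists (b *: z + w); first exact: submodP.
  by rewrite linearP zE wE scalerDl scalerA.
- by exists z => //; apply: submod_chain_le Cz.
exists k => i z Cz; exists 1; split=> //; rewrite scale1r.
have [a za] := gv z; have [|w Cw wa] := Ik i a; first by exists z.
by rewrite (ginj z w) // za wa.
Qed.

Lemma noetherian_at_ann_submod (p I : set R) (V : lmodType R) (P : submod V)
    (v : V) :
    noetherian_ring R -> ~ p 1 ->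
    (forall z, P z -> ann_set V I z -> exists a, z = a *: v) ->
  noetherian_at p (ann (subm P) I).
Proof.
move=> Rnoeth p1 Pv; pose g (z : ann (subm P) I) : V := val (val z).
have glin : linear g by [].
pose G : {linear ann (subm P) I -> V} :=
  HB.pack g (GRing.isLinear.Build R _ V _ g glin).
apply: (@noetherian_at_cyclic _ _ _ G v) => //.
  by move=> z w /val_inj/val_inj.
move=> z; apply: Pv; first exact: subm_valP.
have /set_mem zI : val z \in ann_pred (subm P) I by case: z.
by move=> a /zI/(congr1 val).
Qed.

Definition submod_img (L M : lmodType R) (f : {linear L -> M}) (P : submod L) :
  submod M.
Proof.
apply: (@mk_submod _ _ [set y | exists2 x, P x & f x = y]).
  by exists 0; [apply: submod0 | rewrite raddf0].
move=> a _ _ [x Px <-] [y Py <-]; exists (a *: x + y); first exact: submodP.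
by rewrite linearP.
Defined.

Definition submod_preimg (L M : lmodType R) (f : {linear L -> M}) (P : submod M) :
  submod L.
Proof.
apply: (@mk_submod _ _ [set x | P (f x)]); first by rewrite /= raddf0; apply: submod0.
by move=> a x y Px Py; rewrite /= linearP; apply: submodP.
Defined.

Lemma noetherian_at_serre (p : set R) : Spec R p -> serre (noetherian_at p).
Proof.
move=> Sp; have [_ p1 _] := (SpecP p).1 Sp; split.
(* This is the zero module, since its elements are killed by [1]. *)
- exists (subm (submod_ann R^o setT)); apply: noetherian_at_torsion => z.
  exists 1; split=> //; rewrite scale1r; apply: val_inj.
  by have := subm_valP z 1 Logic.I; rewrite scale1r.
- move=> L M f finj nM C Cmono.
  have [i _ [x Cx <-]|k Ck] := nM (fun i => submod_img f (C i)).
    by exists x => //; apply: Cmono.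
  exists k => i z Cz; have [|s [ps [y Cy yE]]] := Ck i (f z); first by exists z.
  by exists s; split=> //; rewrite (_ : s *: z = y) //; apply: finj; rewrite linearZ.
- move=> M N g gsurj nM C Cmono.
  have [i x /Cmono//|k Ck] := nM (fun i => submod_preimg g (C i)).
  exists k => i z Cz; have [y yz] := gsurj z.
  have [|s [ps Cs]] := Ck i y; first by rewrite /= yz.
  by exists s; split=> //; move: Cs; rewrite /= linearZ yz.
move=> L M N f g finj fg gsurj nL nN C Cmono.
have [i x /Cmono//|k Ck] := nL (fun i => submod_preimg f (C i)).
have [i _ [x Cx <-]|l Cl] := nN (fun i => submod_img g (C i)).
  by exists x => //; apply: Cmono.
(* Some [s *: z] agrees in [N] with an element [y] of [C l]; the difference comes from [L], and some
   [t] outside [p] moves it into [C k]. *)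
exists (maxn k l) => i z Cz.
have [|s [ps [y Cy yE]]] := Cl i (g z); first by exists z.
have [w wE] : exists w, f w = s *: z - y.
  by apply/fg; rewrite linearB linearZ /= yE subrr.
have [|t [pt Ct]] := Ck (maxn i l) w.
  rewrite /= wE; apply: submodB.
    by apply: submodZ; apply: submod_chain_le Cz => //; apply: leq_maxl.
  by apply: submod_chain_le Cy => //; apply: leq_maxr.
exists (t * s); split; first exact: prime_notM.
rewrite -scalerA -[s *: z](subrK y) -wE scalerDr -linearZ.
rewrite -[f _]scale1r; apply: submodP.
  exact: (submod_chain_le Cmono (leq_maxl k l) Ct).
by apply: submodZ; apply: submod_chain_le Cy => //; apply: leq_maxr.
Qed.

End NoetherianAt.

(** * The module A[1/x] / A *)

Section Reciprocals.
Variables (R : comNzRingType) (p0 : set R) (x : R).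
Hypotheses (Sp0 : Spec R p0) (p0x : ~ p0 x).
Implicit Types (f g : {poly R}) (a b t : R).

Let idp0 : ideal p0 := Spec_ideal Sp0.

(* [x ^ n * f (1 / x)], provided that [size f <= n]. *)
Definition reciprocal_eval n f : R := \sum_(i < n) f`_i * x ^+ (n - i).

Lemma reciprocal_evalP n a f g :
  reciprocal_eval n (a *: f + g) = a * reciprocal_eval n f + reciprocal_eval n g.
Proof.
rewrite mulr_sumr -big_split; apply: eq_bigr => i _.
by rewrite coefD coefZ mulrDl mulrA.
Qed.

Lemma reciprocal_evalZ n a f :
  reciprocal_eval n (a *: f) = a * reciprocal_eval n f.
Proof.
rewrite mulr_sumr; apply: eq_bigr => i _.
by rewrite coefZ mulrA.
Qed.

Lemma reciprocal_eval_widen n k f : (size f <= n)%N ->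
  reciprocal_eval (n + k) f = x ^+ k * reciprocal_eval n f.
Proof.
move=> fn; elim: k => [|k IHk]; first by rewrite addn0 mul1r.
rewrite addnS exprS -mulrA -IHk /reciprocal_eval big_ord_recr /=.
rewrite nth_default ?mul0r ?addr0; last exact: leq_trans fn (leq_addr _ _).
rewrite mulr_sumr; apply: eq_bigr => i _.
rewrite subSn; last exact: ltnW.
by rewrite exprS mulrCA.
Qed.

Lemma reciprocal_evalXn n j : (j < n)%N ->
  reciprocal_eval n ('X^j) = x ^+ (n - j).
Proof.
move=> jn; rewrite /reciprocal_eval (bigD1 (Ordinal jn)) //=.
rewrite coefXn eqxx mul1r big1 ?addr0 // => i ij.
rewrite coefXn; case: eqP => [iE|]; last by rewrite mul0r.
by case/eqP: ij; apply: val_inj.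
Qed.

(* With [A := R / p0] and ['X] read as [1 / x], these are the polynomials
   whose value in [A[1/x]] lies in [A]. *)
Definition integral_value : set {poly R} :=
  [set f : {poly R} | exists n, (size f <= n)%N /\
     exists a, p0 (reciprocal_eval n f - a * x ^+ n)].

Lemma integral_value_widen n k f a : (size f <= n)%N ->
    p0 (reciprocal_eval n f - a * x ^+ n) ->
  p0 (reciprocal_eval (n + k) f - a * x ^+ (n + k)).
Proof.
move=> fn fa; rewrite reciprocal_eval_widen // exprD mulrA [_ * x ^+ k]mulrC.
by rewrite -mulrBr; apply: ideal_propM.
Qed.

Lemma integral_value0 : integral_value 0.
Proof.
exists 0%N; rewrite size_poly0; split=> //; exists 0.
by rewrite /reciprocal_eval big_ord0 mul0r subrr; apply: ideal_prop0.
Qed.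

Lemma integral_valueP a f g :
  integral_value f -> integral_value g -> integral_value (a *: f + g).
Proof.
move=> [n [fn [b fb]]] [k [gk [c gc]]].
have fb' := integral_value_widen k fn fb.
have gc' := integral_value_widen n gk gc.
exists (n + k)%N; split.
  apply: leq_trans (size_polyD _ _) _; rewrite geq_max.
  rewrite (leq_trans (size_scale_leq _ _)) ?(leq_trans fn) ?leq_addr //=.
  by rewrite (leq_trans gk) ?leq_addl.
exists (a * b + c); rewrite addnC in gc'.
rewrite reciprocal_evalP mulrDl opprD addrACA -mulrA -mulrBr.
by apply: ideal_propD => //; apply: ideal_propM.
Qed.

Definition integral_submod : submod {poly R} :=
  mk_submod integral_value0 integral_valueP.

Definition reciprocal_mod : lmodType R := quotm integral_submod.

(* The class of [t / x ^ j] in [A[1/x] / A]. *)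
Definition reciprocal t j : reciprocal_mod := quotm_pi integral_submod (t *: 'X^j).

Lemma reciprocalZ a t j : a *: reciprocal t j = reciprocal (a * t) j.
Proof. by rewrite -quotm_piZ scalerA. Qed.

(** Clearing denominators puts a power of [x] times [t - a * x ^+ j] into [p0], and that power
    cancels because [p0] is prime and omits [x]. Widening by [j.+1] provides the bound that [hE]
    requires. *)
Lemma reciprocal_eq0 t j : reciprocal t j = 0 <-> ideal_adjoin p0 (x ^+ j) t.
Proof.
have hE n : (j < n)%N ->
    reciprocal_eval n (t *: 'X^j) = x ^+ (n - j) * t.
  by move=> jn; rewrite reciprocal_evalZ reciprocal_evalXn // mulrC.
rewrite quotm_eq0; split=> [[n [tn [a ta]]]|[a [u pu ->]]].
  have := integral_value_widen j.+1 tn ta.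
  have jn : (j < n + j.+1)%N by rewrite addnS ltnS leq_addl.
  rewrite hE // -[X in a * x ^+ X](subnK (ltnW jn)) exprD mulrCA -mulrBr.
  have [_ _ pM] := (SpecP p0).1 Sp0 => /pM[/(primeX Sp0)//|ptx].
  by exists a, (t - a * x ^+ j); rewrite // addrC subrK.
exists j.+1; split.
  by apply: leq_trans (size_scale_leq _ _) _; rewrite size_polyXn.
exists a; rewrite reciprocal_evalZ reciprocal_evalXn //.
rewrite subSnn expr1 exprSr mulrA -mulrBl addrC addKr.
exact: ideal_propMr.
Qed.

(** All terms of [f] are put over the common denominator [x ^ size f]. *)
Lemma reciprocal_surj (z : reciprocal_mod) :
  exists t j, z = reciprocal t j.
Proof.
have [f ->] := quotm_surj z; pose n := size f.
exists (reciprocal_eval n f), n; apply/quotm_eq.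
exists n.+1; split.
  apply: leq_trans (size_polyD _ _) _; rewrite geq_max leqnSn size_polyN.
  by apply: leq_trans (size_scale_leq _ _) _; rewrite size_polyXn.
exists 0; rewrite mul0r subr0 -[f]scale1r addrC -scaleNr.
rewrite reciprocal_evalP reciprocal_evalXn // subSnn scale1r.
rewrite -[n.+1]addn1 reciprocal_eval_widen // expr1.
by rewrite mulrC mulrN addrC subrr; apply: ideal_prop0.
Qed.

Lemma reciprocal_cancel t i j : reciprocal (x ^+ i * t) (i + j) = reciprocal t j.
Proof.
apply/quotm_eq; exists (i + j).+1; split.
  apply: leq_trans (size_polyD _ _) _; rewrite size_polyN geq_max.
  by rewrite !(leq_trans (size_scale_leq _ _)) ?size_polyXn // ltnS leq_addl.
exists 0; rewrite mul0r subr0 addrC -scaleNr.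
rewrite reciprocal_evalP reciprocal_evalZ !reciprocal_evalXn ?ltnS ?leq_addl //.
rewrite subSnn -addSn addnK mulNr expr1 [x ^+ i * t]mulrC -mulrA -exprSr.
by rewrite addrC subrr; apply: ideal_prop0.
Qed.

Lemma reciprocal_annihilated (z : reciprocal_mod) :
  x *: z = 0 -> exists a, z = reciprocal a 1.
Proof.
have [t [j ->]] := reciprocal_surj z.
(* Writing [t / x^j] as [x t / x^(j+1)] makes the exponent positive, so that one [x] can be
   cancelled modulo [p0] even for [j = 0]. *)
rewrite -(reciprocal_cancel t 1 j) add1n expr1 reciprocalZ.
move=> /reciprocal_eq0[a [u pu xxt]].
exists a; rewrite -(reciprocal_cancel a j 1) addn1.
have pxt : p0 (x * t - a * x ^+ j).
  have : p0 (x * (x * t - a * x ^+ j)).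
    by rewrite mulrBr xxt exprS [x * (a * _)]mulrCA addrC addKr.
  by have [_ _ pM] := (SpecP p0).1 Sp0 => /pM[].
apply/eqP; rewrite -subr_eq0 -quotm_piB -scalerBl; apply/eqP/reciprocal_eq0.
by exists 0, (x * t - a * x ^+ j); rewrite 1?[x ^+ j * a]mulrC ?mul0r ?add0r.
Qed.

End Reciprocals.

(** * Failure of the Melkersson condition on the torsion part of A[1/x] / A *)

Definition torsion_submod (R : comNzRingType) (V : lmodType R) (p : set R) :
  submod V.
Proof.
apply: (@mk_submod _ _ [set z | forall y, p y -> exists n, y ^+ n *: z = 0]).
  by move=> y _; exists 0%N; rewrite scaler0.
move=> a z w hz hw y py; have [i zi] := hz y py; have [j wj] := hw y py.
exists (i + j)%N; rewrite scalerDr scalerA mulrC -scalerA.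
rewrite exprD -[in X in _ + X]scalerA wj scaler0 addr0.
by rewrite mulrC -scalerA zi !scaler0.
Defined.

Lemma Gamma_torsion_submod (R : comNzRingType) (V : lmodType R) (p : set R) :
    noetherian_ring R -> ideal p ->
  Gamma (subm (torsion_submod V p)) p = setT.
Proof.
move=> Rnoeth idp; apply/seteqP; split=> // z _.
apply: Gamma_noetherian => // y py.
by have [n nz] := subm_valP z y py; exists n; apply: val_inj.
Qed.

(** Modulo [J], [y] is a multiple of [x], so [y ^+ n] is one of [x ^+ n]. *)
Lemma ideal_adjoin_pow (R : comNzRingType) (J : set R) (x y : R) n :
  ideal J -> ideal_adjoin J x y -> ideal_adjoin J (x ^+ n) (y ^+ n).
Proof.
move=> idJ [a [u Ju ->]]; elim: n => [|n [b [v Jv vE]]].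
  by rewrite !expr0; apply: mem_ideal_adjoin.
exists (a * b), ((a * x) * v + (b * x ^+ n + v) * u).
  by apply: ideal_propD => //; apply: ideal_propM.
rewrite exprS vE mulrDl [in a * x * _]mulrDr [u * _]mulrC exprS.
by rewrite (mulrACA a) addrA.
Qed.

Section NotMelkersson.
Variables (R : comNzRingType) (p0 p : set R) (x : R).
Hypotheses (Rnoeth : noetherian_ring R) (Sp0 : Spec R p0) (Sp : Spec R p).
Hypotheses (p0p : p0 `<=` p) (px : p x) (p0x : ~ p0 x).
Hypothesis p_min : forall y, p y ->
  exists s n, ~ p s /\ ideal_adjoin p0 x (s * y ^+ n).

(** For each generator [g] of [p], [p_min] gives [s * g ^+ n] in [p0 + (x)] with [s] outside [p];
    its [k]-th power lies in [p0 + (x^k)]. The product [t] of all [s ^+ k] makes [t / x^k] torsion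
    for every generator. *)
Lemma exists_reciprocal_torsion k : exists t, ~ p t /\
  torsion_submod (reciprocal_mod x Sp0) p (reciprocal x Sp0 t k).
Proof.
have idp0 := Spec_ideal Sp0; have idp := Spec_ideal Sp.
have idJ := ideal_adjoin_ideal (x ^+ k) idp0.
have [gs gsE] := Rnoeth idp.
have /choice[f fP] (i : 'I_(size gs)) : exists te,
    ~ p te.1 /\ ideal_adjoin p0 (x ^+ k) (te.1 * gs`_i ^+ te.2).
  have [|s [n [ps sJ]]] := p_min (y := gs`_i).
    by rewrite gsE; apply/ideal_gen_mem/mem_nth.
  exists (s ^+ k, (n * k)%N); split; first by move/(primeX Sp).
  by rewrite /= exprM -exprMn; apply: ideal_adjoin_pow.
pose t := \prod_i (f i).1; exists t; split.
  apply: (big_ind (fun s => ~ p s)) => [|s1 s2|i _].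
  - by case/SpecP: Sp.
  - exact: prime_notM.
  by case: (fP i).
move=> y py; suff : Gamma _ p (reciprocal x Sp0 t k) by move/Gamma_pow; apply.
rewrite gsE; exists (\sum_i (f i).2).+1 => //.
apply: ann_exp_gen => i; rewrite reciprocalZ; apply/(reciprocal_eq0 Sp0 p0x).
rewrite /t (bigD1 i) //= mulrA [_ * (f i).1]mulrC.
by apply: ideal_propMr => //; case: (fP i).
Qed.

Lemma not_melkersson_noetherian_at : ~ melkersson (noetherian_at p) p.
Proof.
have idp := Spec_ideal Sp.
pose P := torsion_submod (reciprocal_mod x Sp0) p.
move=> /(_ (subm P)) Cp.
have PG : Gamma (subm P) p = setT := Gamma_torsion_submod _ Rnoeth idp.
have Pann : noetherian_at p (ann (subm P) p).
  apply: (@noetherian_at_ann_submod _ _ _ _ _ (reciprocal x Sp0 1 1)) => //.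
    by case/SpecP: Sp.
  move=> z _ pz.
  have [a ->] := reciprocal_annihilated p0x (pz x px); exists a.
  by rewrite reciprocalZ mulr1.
(* [C_p] would make [P] noetherian at [p], so the chain [(0 :_P x^i)] would stabilize at [p] from
   some [k] on. *)
have [i z xz _ ->|k Ck] := Cp PG Pann (fun i => submod_ann (subm P) [set x ^+ i]).
  by rewrite exprS -scalerA xz ?scaler0.
(* The class of [t / x^(k+1)] is killed by [x^(k+1)]. If [x^k] killed [s] times it, [s t / x] would
   be in [A], so [s * t] would lie in [p0 + (x)], inside [p], although [s] and [t] are outside the
   prime [p]. *)
have [t [pt Pt]] := exists_reciprocal_torsion k.+1.
have [|s [ps /(_ _ erefl)/(congr1 val)/=]] := Ck k.+1 (to_subm Pt).
  move=> _ ->; apply: val_inj; rewrite /= reciprocalZ.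
  rewrite -[X in reciprocal _ _ _ X]addn0 reciprocal_cancel.
  apply/(reciprocal_eq0 Sp0 p0x); exists t, 0; last by rewrite mulr1 addr0.
  exact: ideal_prop0 (Spec_ideal Sp0).
rewrite !reciprocalZ -addn1 reciprocal_cancel.
move/(reciprocal_eq0 Sp0 p0x) => [a [u pu stE]].
apply: (prime_notM Sp ps pt); rewrite stE; apply: ideal_propD => //.
  by apply: ideal_propM.
exact: p0p.
Qed.

End NotMelkersson.

(** * Dimension of a local ring and the trichotomy for its Serre subcategories *)

Theorem mainTheorem2 (R : comNzRingType)
    (Rnoeth : noetherian_ring R) (Rlocal : local_ring R) :
  (forall S : lmodType R -> Prop, serre S ->
     [\/ melkersson_primes S = Spec R,
         exists2 p : set R, minimal_primes R p & melkersson_primes S = [set p]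
       | melkersson_primes S = set0])
  <-> krull_dim_le R 1.
Proof.
have [m [mm _]] := Rlocal; split; last first.
  by move=> Rdim S Sserre; apply: (melkersson_trichotomy Rnoeth Rlocal Rdim mm).
move=> trich k [c [cS cmono]]; rewrite leqNgt; apply/negP => k1.
have [S0 S1 S2] : [/\ Spec R (c 0), Spec R (c 1) & Spec R (c 2)].
  by split; apply: cS => //; apply: ltnW.
have witness (A B : set R) : A `<` B -> exists2 x, B x & ~ A x.
  move=> [_ nBA]; apply: contrapT => h; apply: nBA => x Bx.
  by apply: contrapT => Ax; apply: h; exists x.
have c01 := cmono 0%N (ltnW k1); have [x c1x c0x] := witness _ _ c01.
have [s c2s c1s] := witness _ _ (cmono 1%N k1).
have [||p [Sp Jp pc1 p_min]] :=
    @exists_min_prime_over _ (ideal_adjoin (c 0%N) x) (c 1%N) _ S1.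
- by apply: ideal_adjoin_ideal; apply: Spec_ideal.
- move=> _ [a [u /(c01.1) c1u ->]]; have id1 := Spec_ideal S1.
  by apply: ideal_propD => //; apply: ideal_propM.
have id0 := Spec_ideal S0.
have nCp : ~ melkersson (noetherian_at p) p.
  apply: (not_melkersson_noetherian_at Rnoeth S0 Sp) p_min => //.
    by apply: subset_trans Jp; apply: sub_ideal_adjoin.
  exact/Jp/mem_ideal_adjoin.
have Sm := maximal_prime mm.
have ps : ~ p s by move/pc1.
(* The element [s] of [c 2] lies in [m] but not in [c 1], hence not in [p]; its powers kill
   [m]-torsion elements without meeting [p]. *)
have Cm : melkersson (noetherian_at p) m.
  move=> M MG _; apply: noetherian_at_torsion => z.
  have mz : Gamma M m z by rewrite MG.
  have [n sz] := Gamma_pow mz (local_prime_sub Rlocal mm S2 c2s).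
  by exists (s ^+ n); split=> // /(primeX Sp).
(* The first case contradicts [nCp] and the last [Cm]. In the middle one [m] is minimal, so
   [c 0 = m] contains [c 1], against [c 0] being strictly inside [c 1]. *)
have [E|[q [Sq qmin] E]|E] := trich _ (noetherian_at_serre Sp).
- by have [] : melkersson_primes (noetherian_at p) p by rewrite E.
- have mq : m = q by have : melkersson_primes (noetherian_at p) m by []; rewrite E.
  apply: c1s; have := local_prime_sub Rlocal mm S1.
  have <- : c 0%N = m.
    by rewrite mq; apply: qmin => //; rewrite -mq; apply: local_prime_sub.
  by move=> c10; case: c01.
- by have : melkersson_primes (noetherian_at p) m by []; rewrite E.
Qed.
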